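(* Suppose that $(M,\omega)$ is a weighted brick complex such that there is an interior facet of $M$ (a facet not in $\partial M$) on which $\omega$ is non-zero. Then $M$ contains a stable or unstable minimal surface.
   Context: **Brick complexes.** A $0$-brick is a single point. For $n\ge 1$, an $n$-brick is a compact $n$-dimensional manifold $T$ with $\partial T$ tiled by finitely many $(n-1)$-bricks, called the facets of $T$. Tilings are face-to-face, so each $(n-2)$-dimensional face in $\partial T$ is a facet of exactly two facets of $T$. Faces of $T$ are defined recursively: facets, facets of facets, etc. A gluing map from an $n$-brick $T_1$ to a distinct $n$-brick $T_2$ is a homeomorphism from the union of some facets of $T_1$ to the union of some facets of $T_2$ taking each face to a face. An ($n$-dimensional) brick complex $M$ (or $(M,\mathcal{T})$) is a topological space $M$ with a finite collection $\mathcal{T}$ of $n$-bricks and gluing maps between them such that each facet of each brick is contained in the domain or range of at most one gluing map, and $M$ is homeomorphic to the resulting quotient space. Images in $M$ of the $n$-bricks and of their facets are again called bricks and facets. Thus each facet of $M$ is a facet of either one or two (distinct) bricks. $\mathcal{F}$ is the set of facets of $M$, and $\partial M$ is the set of facets adjacent to exactly one brick. For a brick $A$, $\partial A$ is its set of facets and $\partial_I A$ is the set of facets of $A$ not in $\partial M$ (interior facets). **Surfaces and weights.** A surface $S\subset M$ is a union of facets, identified with its set of facets (the facets ''in'' $S$); the empty surface is allowed. The facets ''of'' $S$ are the $(n-2)$-dimensional faces of $M$ belonging to $S$. $S$ is proper if no facet in $S$ is in $\partial M$ and, for every $(n-2)$-dimensional face $\alpha$ belonging to $S$ and not lying in $\partial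 M$, the number of facets in $S$ having $\alpha$ as a facet is even (counted with multiplicity: a facet $F$ in $S$ is counted once for each facet of the brick $F$ whose image in $M$ is $\alpha$). $S_1\sqcap S_2$ denotes the set of facets common to $S_1$ and $S_2$ (and $A\sqcap S$ means $\partial A\sqcap S$ for a brick $A$). A weight system is a function $\omega:\mathcal{F}\to[0,\infty)$; the weight $\omega(S)$ of a union of facets is the sum of the weights of its facets. $(M,\omega)$ is then a weighted brick complex. For a brick $A$ and a surface $S$, $\partial_S A$ is the set of facets of $\partial_I A$ in $S$, $\partial'_S A$ is the set of facets of $\partial_I A$ not in $S$, and the strength of $A$ relative to $S$ is $\sigma(A;S)=\omega(\partial'_S A)-\omega(\partial_S A)$. $A$ is a shortening move for $S$ if $A\sqcap S\ne\varnothing$ and $\sigma(A;S)\le 0$; it is a strict shortening move if moreover $\sigma(A;S)<0$. **Minimal surfaces.** A proper surface $S$ is a stable minimal surface if it has no strict shortening moves. A proper surface $S$ is an unstable minimal surface if there is a partition of the bricks of $M$ into two non-empty sets $\mathcal{A},\mathcal{B}$ such that: (i) if $A\in\mathcal{A}$ and $B\in\mathcal{B}$, then $\partial A\sqcap\partial B\subset S$; (ii) each of $\mathcal{A}$ and $\mathcal{B}$ contains a shortening move for $S$ and one of them contains a strict shortening move; (iii) for each strict shortening move $A\in\mathcal{A}$ (resp. $B\in\mathcal{B}$) there exists a shortening move $B\in\mathcal{B}$ (resp. $A\in\mathcal{A}$) such that $2\omega(\partial A\sqcap\partial B)\ge|\sigma(A;S)|+|\sigma(B;S)|$; (iv) for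 all strict shortening moves $A\in\mathcal{A}$ and strict shortening moves $B\in\mathcal{B}$, $2\omega(\partial A\sqcap\partial B)\ge|\sigma(A;S)|+|\sigma(B;S)|$. *)

(* Defs.v *)
From HB Require Import structures.
From mathcomp Require Import all_boot all_order all_algebra generic_quotient.
From mathcomp Require Import all_classical all_reals all_analysis.
From Stdlib Require Import Relation_Operators.

Set Implicit Arguments.
Unset Strict Implicit.
Unset Printing Implicit Defensive.

Import Order.TTheory GRing.Theory Num.Theory.
Import numFieldTopology.Exports.

Local Open Scope classical_set_scope.
Local Open Scope ring_scope.
Local Open Scope quotient_scope.

Definition homeo_on (X Y : topologicalType) (A : set X) (B : set Y)
    (f : X -> Y) : Prop :=
  exists g : Y -> X,
    [/\ set_fun A B f, set_fun B A g,
        {in A, cancel f g} /\ {in B, cancel g f},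
        {within A, continuous f} & {within B, continuous g}].

Section Manifolds.
Variables (R : realType) (X : topologicalType).

Definition half_space (k : nat) : set 'rV[R]_k.+1 :=
  [set v | 0 <= v ord0 ord0].

Definition euclidean_at (k : nat) (A : set X) (x : X) : Prop :=
  exists (U : set X) (V : set 'rV[R]_k.+1) (f : X -> 'rV[R]_k.+1),
    [/\ open U, U x, open V & homeo_on (A `&` U) V f].

Definition half_euclidean_at (k : nat) (A : set X) (x : X) : Prop :=
  exists (U : set X) (V : set 'rV[R]_k.+1) (f : X -> 'rV[R]_k.+1),
    [/\ open U, U x, open V & homeo_on (A `&` U) (V `&` @half_space k) f].

(* The subset A is a (k+1)-manifold with boundary.  The Hausdorff and
   second-countability axioms are imposed on the ambient space of a brick and
   are inherited by all its subsets.  A point in an interior chart also has a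
   half-space chart, so half-space charts suffice. *)
Definition manifold (k : nat) (A : set X) : Prop :=
  forall x, A x -> half_euclidean_at k A x.

Definition manifold_boundary (k : nat) (A : set X) : set X :=
  [set x | A x /\ ~ euclidean_at k A x].

End Manifolds.
Arguments manifold R {X} k A.
Arguments manifold_boundary R {X} k A.

(* The recursive definition of a brick is laid out as a finite graded poset:
   face labels all faces of the brick (itself, its facets, the facets of its
   facets, ...), [facets f] is the set of facets of f, and every face f is
   required to be a (dim f)-brick.  Sharing one label set between all facets is
   what makes the tilings of two adjacent facets agree along common faces. *)
Section FaceStructure.
Variables (R : realType) (X : topologicalType) (face : finType).
Variables (cell : face -> set X) (dim : face -> nat).
Variable facets : face -> {set face}.

Definition is_face (c f : face) : bool :=
  connect [rel a b | b \in facets a] f c.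

(* Face-to-face: distinct facets meet in a union of common faces, which are
   proper by the grading, so their relative interiors are disjoint. *)
Definition tiles_boundary (k : nat) (f : face) : Prop :=
  [/\ manifold_boundary R k (cell f) = \bigcup_(g in [set` facets f]) cell g,
      forall g h, g \in facets f -> h \in facets f -> g != h ->
        cell g `&` cell h =
        \bigcup_(c in [set c | is_face c g && is_face c h]) cell c
    & forall g c, g \in facets f -> c \in facets g ->
        #|[set h in facets f | c \in facets h]%SET| = 2%N].

Definition brick_face (f : face) : Prop :=
  match dim f with
  | 0%N => (exists x, cell f = [set x]) /\ facets f = finset.set0
  | k.+1 => [/\ cell f !=set0, compact (cell f), manifold R k (cell f)
              & tiles_boundary k f]
  end.

End FaceStructure.

Record brick (R : realType) (n : nat) := Brick {
  bspace :> topologicalType;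
  face : finType;
  cell : face -> set bspace;
  dim : face -> nat;
  facets : face -> {set face};
  top : face;
  bspace_hausdorff : hausdorff_space bspace;
  bspace_countable : @second_countable bspace;
  cell_inj : injective cell;
  cell_top : cell top = [set: bspace];
  dim_top : dim top = n;
  dim_facet : forall f g, g \in facets f -> (dim g).+1 = dim f;
  face_top : forall f, is_face facets f top;
  faceP : forall f, brick_face R cell dim facets f
}.
Arguments face {R n} b.
Arguments cell {R n b} f.
Arguments dim {R n b} f.
Arguments facets {R n b} f.
Arguments top {R n} b.

Definition union_of (R : realType) (n : nat) (B : brick R n)
    (D : {set face B}) : set B :=
  \bigcup_(f in [set` D]) cell f.

(* In gluing_faces, [dim c' = dim c] makes explicit what follows anyway from
   invariance of dimension. *)
Record gluing (R : realType) (n : nat) (B1 B2 : brick R n) := Gluing {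
  gdom : {set face B1};
  gcod : {set face B2};
  gmap : B1 -> B2;
  gdom_facets : gdom \subset facets (top B1);
  gcod_facets : gcod \subset facets (top B2);
  gmap_homeo : homeo_on (union_of gdom) (union_of gcod) gmap;
  gluing_faces : forall f c, f \in gdom -> is_face facets c f ->
    exists c' : face B2, dim c' = dim c /\ gmap @` cell c = cell c'
}.

Record gluing_data (R : realType) (n : nat) := GluingData {
  piece : finType;
  piece_brick : piece -> brick R n;
  glue : finType;
  src : glue -> piece;
  tgt : glue -> piece;
  src_neq_tgt : forall k, src k != tgt k;
  glue_map : forall k, gluing (piece_brick (src k)) (piece_brick (tgt k));
  glue_once : forall (p : {i : piece & face (piece_brick i)}) (k1 k2 : glue),
    let used k :=
      (exists2 f, f \in gdom (glue_map k) & p = existT _ (src k) f) \/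
      (exists2 f, f \in gcod (glue_map k) & p = existT _ (tgt k) f) in
    used k1 -> used k2 -> k1 = k2
}.
Arguments piece_brick {R n g} i.
Arguments src {R n g} k.
Arguments tgt {R n g} k.
Arguments glue_map {R n g} k.

Section GluedSpace.
Variables (R : realType) (n : nat) (D : gluing_data R n).

Definition pieces : topologicalType :=
  {i : piece D & (piece_brick i : topologicalType)}.

Definition glue_step (x y : pieces) : Prop :=
  exists (k : glue D) (p : piece_brick (src k)),
    [/\ union_of (gdom (glue_map k)) p,
        x = existT _ (src k) p &
        y = existT _ (tgt k) (gmap (glue_map k) p)].

Definition glue_eq (x y : pieces) : bool :=
  `[< clos_refl_sym_trans pieces glue_step x y >].

Lemma glue_eq_refl : reflexive glue_eq.
Proof. by move=> x; apply/asboolP; exact: rst_refl. Qed.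

Lemma glue_eq_sym : symmetric glue_eq.
Proof.
by move=> x y; apply/asboolP/asboolP => h; exact: rst_sym.
Qed.

Lemma glue_eq_trans : transitive glue_eq.
Proof.
move=> y x z /asboolP xy /asboolP yz; apply/asboolP.
exact: rst_trans xy yz.
Qed.

Definition glue_rel : equiv_rel pieces :=
  EquivRel glue_eq glue_eq_refl glue_eq_sym glue_eq_trans.

Definition glued : topologicalType := quotient_topology {eq_quot glue_rel}.

Definition glued_point (i : piece D) (x : piece_brick i) : glued :=
  \pi_{eq_quot glue_rel} (existT _ i x : pieces).

End GluedSpace.
Arguments glued_point {R n D} i x.

Record brick_complex (R : realType) (n : nat) := BrickComplex {
  cdata : gluing_data R n;
  cspace :> topologicalType;
  cmap : glued cdata -> cspace;
  cmap_homeo : homeo_on [set: glued cdata] [set: cspace] cmap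
}.
Arguments cmap {R n} b.

Section Surfaces.
Variables (R : realType) (n : nat) (M : brick_complex R n).

(* The bricks of M are indexed by the pieces (their images in M are pairwise
   distinct); the facets of M and their facets are subsets of M. *)
Definition cbrick : finType := piece (cdata M).

Definition cimage (A : cbrick) (c : face (piece_brick A)) : set M :=
  [set cmap M (glued_point A x) | x in cell c].

Definition brick_facets (A : cbrick) : set (set M) :=
  [set cimage f | f in [set` facets (top (piece_brick A))]].

Definition cfacets : set (set M) := \bigcup_(A : cbrick) brick_facets A.

Definition boundary_facets : set (set M) :=
  [set F | exists! A : cbrick, brick_facets A F].

Definition interior_facets : set (set M) := cfacets `\` boundary_facets.

Definition brick_interior_facets (A : cbrick) : set (set M) :=
  brick_facets A `\` boundary_facets.

(* The number of facets of the brick F whose image in M is a.  F is the image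
   of one or two facets f of pieces; in the second case these are matched face
   by face by a gluing map, so the set below is a singleton for F in cfacets. *)
Definition multiplicity (F a : set M) : nat :=
  xget 0%N [set m | exists (A : cbrick) (f : face (piece_brick A)),
    [/\ f \in facets (top (piece_brick A)), cimage f = F &
        m = #|[set c in facets f | cimage c == a]%SET|]].

Definition facets_of (S : set (set M)) : set (set M) :=
  [set a | exists (A : cbrick) (f c : face (piece_brick A)),
    [/\ f \in facets (top (piece_brick A)), S (cimage f),
        c \in facets f & a = cimage c]].

Definition surface (S : set (set M)) : Prop := S `<=` cfacets.

Definition proper_surface (S : set (set M)) : Prop :=
  [/\ surface S, S `&` boundary_facets = set0
    & forall a, facets_of S a -> ~ a `<=` \bigcup_(F in boundary_facets) F ->
        ~~ odd (\sum_(F \in S) multiplicity F a)].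

Definition weight_system (w : set M -> R) : Prop :=
  forall F, cfacets F -> 0 <= w F.

Variable w : set M -> R.

Definition weight (S : set (set M)) : R := \sum_(F \in S) w F.

Definition strength (A : cbrick) (S : set (set M)) : R :=
  weight (brick_interior_facets A `\` S) - weight (brick_interior_facets A `&` S).

Definition shortening (S : set (set M)) (A : cbrick) : Prop :=
  brick_facets A `&` S !=set0 /\ strength A S <= 0.

Definition strict_shortening (S : set (set M)) (A : cbrick) : Prop :=
  shortening S A /\ strength A S < 0.

Definition stable_minimal (S : set (set M)) : Prop :=
  proper_surface S /\ forall A, ~ strict_shortening S A.

Definition compensates (S : set (set M)) (A B : cbrick) : Prop :=
  `|strength A S| + `|strength B S| <=
  2 * weight (brick_facets A `&` brick_facets B).

Definition unstable_partition (S : set (set M)) (P Q : {set cbrick}) : Prop :=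
  [/\ forall A B, A \in P -> B \in Q -> brick_facets A `&` brick_facets B `<=` S,
      [/\ exists2 A, A \in P & shortening S A,
          exists2 B, B \in Q & shortening S B
        & exists2 A, A \in P :|: Q & strict_shortening S A]%SET,
      (forall A, A \in P -> strict_shortening S A ->
         exists B, [/\ B \in Q, shortening S B & compensates S A B]) /\
      (forall B, B \in Q -> strict_shortening S B ->
         exists A, [/\ A \in P, shortening S A & compensates S A B])
    & forall A B, A \in P -> B \in Q ->
        strict_shortening S A -> strict_shortening S B -> compensates S A B].

Definition unstable_minimal (S : set (set M)) : Prop :=
  proper_surface S /\
  exists P Q : {set cbrick},
    [/\ P :|: Q = [set: cbrick], P :&: Q = finset.set0,
        P != finset.set0, Q != finset.set0 & unstable_partition S P Q]%SET.

End Surfaces.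

(* Main.v *)
Require Import Defs.
From mathcomp Require Import finmap.
From mathcomp Require Import all_boot all_order all_algebra generic_quotient.
From mathcomp Require Import all_classical all_reals all_analysis.
From mathcomp Require Import ring lra.
From Stdlib Require Import Relation_Operators Eqdep_dec.

(** Every set [X] of bricks has a separating surface: the facets shared by a
    brick of [X] and a brick outside [X].  The desired surface is one of these,
    and it is found by a mountain-pass argument on the sets of bricks.

    Separating surfaces are proper.  In the boundary of one brick every
    codimension-two face lies in exactly two facets, so the facets of the bricks
    of [X] contain a given face an even number of times in total.  A facet with
    both its bricks in [X] is counted twice in this total, a facet in the
    boundary of [M] has no facet lying outside the boundary, and what remains is
    the separating surface ([separating_proper]).  This needs two
    facts on the quotient space: a facet of [M] belongs to at most two bricks
    ([brick_facets3]), and both bricks see the same number of facets of it over a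
    given face ([multiplicityE]).  Both follow by looking at points in the
    relative interior of a face: such a point lies in no other face of the same
    dimension, hence its class in the quotient has at most two elements, and it
    is recognised topologically, as a point where the face is locally Euclidean.

    Moving a brick [A] across the separating surface of [X] changes its weight
    by exactly the strength of [A] ([strength_separating]).  So strict shortening
    moves are the weight-decreasing flips of [X], and a nonempty separating
    surface without decreasing flips is a stable minimal surface.  Suppose there
    is none.  Then a set without decreasing flips separates nothing, and in
    particular has the two bricks [A0] and [B0] of a chosen interior facet on
    the same side.  Every set descends through decreasing flips to such a set,
    and is labelled by the side on which [A0] ends up (both labels may be
    possible).  The empty set has the label outside and the full set the label
    inside; hence there are passes, that is, equal or adjacent sets carrying the
    two labels.  Take a pass of least height.  Strictly below it, labels are
    unique and constant under flips.  If two decreasing flips at the pass lead to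
    different labels, then performing both cannot lead below the pass, and this
    forces the two bricks to be on opposite sides of the surface and to share
    enough weight to compensate both gains.  If the pass consists of two sets of
    equal height with one label each, then the flip between them, which costs
    nothing, takes the part of the second decreasing flip.  These are the
    conditions of an unstable minimal surface ([saddle_exists],
    [saddle_unstable]). *)

Set Implicit Arguments.
Unset Strict Implicit.
Unset Printing Implicit Defensive.

Import Order.TTheory GRing.Theory Num.Theory.
Import numFieldTopology.Exports.

Local Open Scope classical_set_scope.
Local Open Scope ring_scope.

(** * Mountain pass for cuts of a weighted graph *)

Section MountainPass.
Variables (R : realFieldType) (V : finType) (e : V -> V -> R).
Hypotheses (e_sym : forall A B, e A B = e B A) (e_ge0 : forall A B, 0 <= e A B).
Hypothesis e_irr : forall A, e A A = 0.
Implicit Types (X Y Z : {set V}) (A B C : V).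

Definition spin X A : R := if A \in X then 1 else -1.

Definition flip X A : {set V} := [set B | (B \in X) (+) (B == A)]%SET.

(** When [e A B] is the weight of the facets shared by [A] and [B], this is the
    strength of [A] relative to the surface that separates [X]: shared weight
    counts positively on the same side and negatively across the surface. *)
Definition flip_cost X A : R := \sum_B e A B * (spin X A * spin X B).

Definition opposite X A B : bool := (A \in X) != (B \in X).

(** Up to an additive constant, four times the weight of the cut [X]: a pair
    of vertices occurs in both orders, so that it contributes [-2 e] when it is
    on one side and [+2 e] when it is cut. *)
Definition energy X : R := - \sum_A flip_cost X A.

Lemma spin_flip X A B : spin (flip X A) B = if B == A then - spin X B else spin X B.
Proof. by rewrite /spin /flip inE; case: (B \in X); case: eqP => //= _; rewrite opprK. Qed.

Lemma flipK X A : flip (flip X A) A = X.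
Proof. by apply/setP=> B; rewrite !inE -addbA addbb addbF. Qed.

Lemma flipC X A B : flip (flip X A) B = flip (flip X B) A.
Proof. by apply/setP=> C; rewrite !inE addbAC. Qed.

Lemma spin_opposite X A B : spin X A * spin X B = if opposite X A B then -1 else 1.
Proof.
by rewrite /spin /opposite; case: (A \in X); case: (B \in X); rewrite ?mulr1 ?mul1r // mulrNN mulr1.
Qed.

Lemma flip_cost_flip X A B : A != B ->
  flip_cost (flip X B) A = flip_cost X A - e A B * (spin X A * spin X B) *+ 2.
Proof.
move=> AB; rewrite /flip_cost (bigD1 B) //= [in RHS](bigD1 B) //=.
rewrite !spin_flip (negbTE AB) eqxx; under eq_bigr => C /negbTE CB.
  rewrite spin_flip CB; over.
rewrite mulr2n; ring.
Qed.

Lemma flip_cost_flip_self X A : flip_cost (flip X A) A = - flip_cost X A.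
Proof.
rewrite /flip_cost -sumrN; apply: eq_bigr => B _; rewrite !spin_flip eqxx.
by case: eqP => [->|_]; rewrite ?e_irr ?mul0r ?oppr0 // mulNr mulrN.
Qed.

Lemma energy_flip X A : energy (flip X A) = energy X + flip_cost X A *+ 4.
Proof.
rewrite /energy (bigD1 A) //= [in RHS](bigD1 A) //= flip_cost_flip_self.
under eq_bigr => B BA do rewrite flip_cost_flip //.
rewrite big_split /= sumrN sumrMnl.
have -> : \sum_(i | i != A) e i A * (spin X i * spin X A) = flip_cost X A.
  rewrite /flip_cost [in RHS](bigD1 A) //= e_irr mul0r add0r.
  by apply: eq_bigr => B _; rewrite e_sym [spin X B * _]mulrC.
ring.
Qed.

(** The two costs ignore the interaction of [A] and [B]: an edge between opposite
    sides is cut before and after both flips but is gained twice in the costs;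
    on the same side it is the other way round. *)
Lemma energy_flip2 X A B : A != B -> energy (flip (flip X A) B) =
  energy X + (flip_cost X A + flip_cost X B
     + (if opposite X A B then e A B else - e A B) *+ 2) *+ 4.
Proof.
move=> AB; rewrite !energy_flip flip_cost_flip 1?eq_sym // spin_opposite.
rewrite [e B A]e_sym /opposite [_ == (A \in X)]eq_sym; case: ifP => _; ring.
Qed.

Lemma lt_energy_flip X A : (energy (flip X A) < energy X) = (flip_cost X A < 0).
Proof. by rewrite energy_flip gtrDl pmulrn_llt0. Qed.

Definition descent : rel {set V} :=
  [rel X Y | [exists A, (Y == flip X A) && (flip_cost X A < 0)]].

(** Local minima for flips; in the application they separate nothing. *)
Definition stuck X := [forall A, 0 <= flip_cost X A].

Lemma descentP X A : flip_cost X A < 0 -> descent X (flip X A).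
Proof. by move=> s; apply/existsP; exists A; rewrite eqxx. Qed.

Lemma not_stuck X : ~~ stuck X -> exists A, flip_cost X A < 0.
Proof. by rewrite negb_forall => /existsP[A]; rewrite -ltNge; exists A. Qed.

Lemma flip_cost_const X A (b : bool) : (forall B, (B \in X) = b) -> 0 <= flip_cost X A.
Proof.
move=> Xb; apply: sumr_ge0 => B _; rewrite mulr_ge0 // spin_opposite.
by rewrite /opposite !Xb eqxx.
Qed.

Variables A0 B0 : V.
Hypothesis AB0 : A0 != B0.
Hypothesis stuck_sides : forall X, stuck X -> (A0 \in X) = (B0 \in X).

(** [b] tells the side of [A0] (equivalently of [B0]) at the bottom of some
    descent from [X]; both values may be possible for the same [X]. *)
Definition falls_to b X :=
  [exists Z, [&& connect descent X Z, stuck Z & (A0 \in Z) == b]].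

Lemma falls_to_descent b X Y : descent X Y -> falls_to b Y -> falls_to b X.
Proof.
move=> XY /existsP[Z /and3P[YZ sZ bZ]]; apply/existsP; exists Z.
by rewrite sZ bZ (connect_trans (connect1 XY) YZ).
Qed.

Lemma falls_to_flip b X A : flip_cost X A < 0 -> falls_to b (flip X A) -> falls_to b X.
Proof. by move/descentP; exact: falls_to_descent. Qed.

Lemma falls_to_stuck b X : stuck X -> falls_to b X = ((A0 \in X) == b).
Proof.
move=> sX; apply/existsP/idP => [[Z /and3P[XZ _ bZ]]|bX]; last first.
  by exists X; rewrite connect0 sX.
case/connectP: XZ bZ => -[|Y p] /= => [_ -> //|/andP[/existsP[A /andP[_]]]].
by rewrite ltNge (forallP sX A).
Qed.

Lemma falls_toE b X : ~~ stuck X -> falls_to b X ->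
  exists2 A, flip_cost X A < 0 & falls_to b (flip X A).
Proof.
move=> sX /existsP[Z /and3P[/connectP[[|Y p] /= pp eZ] sZ bZ]].
  by move: sX; rewrite -eZ sZ.
case/andP: pp => /existsP[A /andP[/eqP eY sA]] pp.
exists A => //; apply/existsP; exists Z; rewrite sZ bZ -eY.
by rewrite /= andbT; apply/connectP; exists p.
Qed.

Lemma falls_to_some X : exists b, falls_to b X.
Proof.
have [m] := ubnP #|[set Y | energy Y < energy X]%SET|; elim: m X => // m IH X ltm.
have [sX|/not_stuck[A sA]] := boolP (stuck X).
  by exists (A0 \in X); rewrite falls_to_stuck.
have lt : energy (flip X A) < energy X by rewrite lt_energy_flip.
case: (IH (flip X A)) => [|b fb]; last by exists b; exact: falls_to_flip fb.
rewrite ltnS in ltm; apply: leq_trans ltm; apply: proper_card; apply/properP.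
split; first by apply/fintype.subsetP=> Y; rewrite !inE => /lt_trans; apply.
by exists (flip X A); rewrite !inE ?lt // ltxx.
Qed.

Definition near X Y := (Y == X) || [exists A, Y == flip X A].

Lemma near_flip X A : near X (flip X A).
Proof. by apply/orP; right; apply/existsP; exists A. Qed.

Lemma flip_near X A : near (flip X A) X.
Proof. by rewrite -{2}(flipK X A) near_flip. Qed.

Definition pass (p : {set V} * {set V}) :=
  [&& near p.1 p.2, falls_to false p.1 & falls_to true p.2].

(** The empty set has the label [false] and the full set the label [true].  A set
    of maximal cardinality among those labelled [false] forms a pass with any
    set obtained by adding one vertex, or by itself if it is the full set. *)
Lemma pass_exists : exists p, pass p.
Proof.
have f0 : falls_to false finset.set0.
  rewrite falls_to_stuck ?inE //; apply/forallP => A.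
  by apply: (@flip_cost_const _ _ false) => B; rewrite inE.
case: (@arg_maxnP _ _ (falls_to false) (fun X : {set V} => #|X|) f0) => X fX maxX.
have [/forallP XT|/forallPn[A AX]] := boolP [forall A, A \in X].
  exists (X, X); rewrite /pass /near eqxx fX /=.
  have sX : stuck X by apply/forallP => A; apply: (@flip_cost_const _ _ true).
  by rewrite falls_to_stuck // XT.
exists (X, flip X A); rewrite /pass near_flip fX /=.
case: (falls_to_some (flip X A)) => -[//|/maxX /=].
rewrite leqNgt => /negP[]; apply: proper_card; apply/properP; split.
  apply/fintype.subsetP => B BX; rewrite inE BX; case: eqP => // eB.
  by rewrite -eB BX in AX.
by exists A; rewrite // inE eqxx (negbTE AX).
Qed.

Definition height (p : {set V} * {set V}) := Num.max (energy p.1) (energy p.2).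

(** The conditions on an unstable minimal surface, in a form that does not name
    the two sides.  The second one bounds the shared weight from below by a
    positive number, so the partner [B] does touch the surface. *)
Definition saddle X :=
  [/\ exists A, flip_cost X A < 0,
      forall A, flip_cost X A < 0 -> exists B,
        [/\ opposite X A B, flip_cost X B <= 0
          & `|flip_cost X A| + `|flip_cost X B| <= e A B *+ 2]
    & forall A B, opposite X A B -> flip_cost X A < 0 -> flip_cost X B < 0 ->
        `|flip_cost X A| + `|flip_cost X B| <= e A B *+ 2].

Section BelowPass.
Variable h : R.
Hypothesis lowest : forall p, pass p -> h <= height p.

(** Two neighbours below the lowest pass with different labels would be a lower
    pass. *)
Lemma below_agree b c X Y : near X Y -> near Y X ->
  energy X < h -> energy Y < h -> falls_to b X -> falls_to c Y -> b = c.
Proof.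
move=> XY YX lX lY; case: b; case: c => // fX fY.
  have := lowest (p := (Y, X)); rewrite /pass /= YX fX fY => /(_ isT).
  by rewrite leNgt /height gt_max lX lY.
have := lowest (p := (X, Y)); rewrite /pass /= XY fX fY => /(_ isT).
by rewrite leNgt /height gt_max lX lY.
Qed.

Lemma below_flip b c X A : energy X < h -> energy (flip X A) < h ->
  falls_to b X -> falls_to c (flip X A) -> b = c.
Proof. by apply: below_agree; rewrite ?near_flip ?flip_near. Qed.

(** If the second flip carries a label incompatible with the first, then
    performing both cannot end below the pass, as the label would be shared with
    [flip X A].  Since each flip alone does not raise the energy, the interaction
    term must be the positive one, and at least as large as both gains. *)
Lemma flips_compensate X A B b : energy X = h ->
  flip_cost X A < 0 -> flip_cost X B <= 0 ->
  falls_to b (flip X A) -> (forall c, energy (flip (flip X A) B) < h ->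
    falls_to c (flip (flip X A) B) -> c = ~~ b) -> A != B ->
  opposite X A B /\ `|flip_cost X A| + `|flip_cost X B| <= e A B *+ 2.
Proof.
move=> eX sA sB fA fAB AB.
have : h <= energy (flip (flip X A) B).
  rewrite leNgt; apply/negP => lt.
  have [c fc] := falls_to_some (flip (flip X A) B).
  have lA : energy (flip X A) < h by rewrite -eX lt_energy_flip.
  have := below_flip lA lt fA fc; rewrite (fAB _ lt fc).
  by case: (b).
rewrite energy_flip2 // eX lerDl pmulrn_lge0 // ltr0_norm // ler0_norm //.
have := e_ge0 A B; rewrite !mulr2n; case: ifP => _ e0 H; split => //; lra.
Qed.

(** At a set with both labels some decreasing flips lead to one label and some
    to the other, and those pairs compensate.  In particular they are opposite,
    so decreasing flips on opposite sides always lead to different labels. *)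
Lemma saddle_of_two_ways X : energy X = h ->
  falls_to false X -> falls_to true X -> saddle X.
Proof.
move=> eX f0 f1.
have nsX : ~~ stuck X.
  apply/negP => sX; move: f0 f1; rewrite !falls_to_stuck //.
  by case: (A0 \in X).
have way b : exists2 A, flip_cost X A < 0 & falls_to b (flip X A).
  by apply: falls_toE => //; case: b.
have comp A B b : flip_cost X A < 0 -> flip_cost X B < 0 ->
    falls_to b (flip X A) -> falls_to (~~ b) (flip X B) ->
    opposite X A B /\ `|flip_cost X A| + `|flip_cost X B| <= e A B *+ 2.
  move=> sA sB fA fB.
  have lB : energy (flip X B) < h by rewrite -eX lt_energy_flip.
  apply: (flips_compensate eX sA (ltW sB) fA) => [c lt fc|].
    by rewrite flipC in lt fc; rewrite (below_flip lB lt fB fc).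
  apply/eqP => AB; rewrite -AB in fB lB.
  have := below_agree _ _ lB lB fA fB; rewrite /near eqxx => /(_ isT isT).
  by case: (b).
split.
- by have [A sA _] := way true; exists A.
- move=> A sA; have [b fA] := falls_to_some (flip X A).
  have [B sB fB] := way (~~ b); exists B.
  by have [oAB cAB] := comp _ _ _ sA sB fA fB; split => //; exact: ltW.
- move=> A B oAB sA sB; have [b fA] := falls_to_some (flip X A).
  have [c fB] := falls_to_some (flip X B).
  have [bc|bc] := eqVneq c (~~ b).
    by rewrite bc in fB; have [] := comp _ _ _ sA sB fA fB.
  have {}bc : c = b by case: (b) (c) bc => [] [].
  rewrite {c}bc in fB; have [D sD fD] := way (~~ b).
  have [oA _] := comp _ _ _ sA sD fA fD; have [oB _] := comp _ _ _ sB sD fB fD.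
  move: oAB oA oB; rewrite /opposite.
  by case: (A \in X); case: (B \in X); case: (D \in X).
Qed.

(** When the pass consists of two sets of equal energy, the flip between them
    costs nothing and compensates every decreasing flip of [X]; all of these are
    opposite to [B], hence on one side. *)
Lemma saddle_of_level_pair b X B : energy X = h -> energy (flip X B) = h ->
  ~~ stuck X -> ~ falls_to (~~ b) X -> ~ falls_to b (flip X B) -> saddle X.
Proof.
move=> eX eY nsX fX fY.
have sB : flip_cost X B = 0.
  move: eY; rewrite energy_flip eX => /eqP; rewrite addrC -subr_eq0 addrK.
  by rewrite mulrn_eq0 => /eqP.
have comp A : flip_cost X A < 0 -> 
    opposite X A B /\ `|flip_cost X A| + `|flip_cost X B| <= e A B *+ 2.
  move=> sA; have [c fA] := falls_to_some (flip X A).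
  have cb : c = b.
    have := falls_to_flip sA fA; move: fX; case: (b) (c) => [] [] //.
  rewrite {}cb in fA.
  apply: (flips_compensate eX sA _ fA) => [|c' lt fc|]; first by rewrite sB.
    move: (fY); case: (eqVneq c' b) => [<- []|]; last by case: (b) (c') => [] [].
    rewrite flipC in lt fc; apply: falls_to_flip fc.
    by rewrite -lt_energy_flip eY.
  by apply/eqP => AB; rewrite AB sB ltxx in sA.
split.
- exact: not_stuck.
- by move=> A sA; have [oA cA] := comp A sA; exists B; split; rewrite // sB.
- move=> A C oAC sA sC; have [oA _] := comp A sA; have [oC _] := comp C sC.
  move: oAC oA oC; rewrite /opposite.
  by case: (A \in X); case: (B \in X); case: (C \in X).
Qed.

End BelowPass.

(** At a lowest pass, either one of the two sets carries both labels, or both sets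
    are at the same height with one label each.  In the latter case they are not
    both stuck, since a single flip cannot move [A0] and [B0] together. *)
Lemma saddle_exists : exists X, saddle X.
Proof.
have [p0 pp0] := pass_exists.
case: (@arg_minP _ _ _ p0 pass height pp0) => -[X Y] pXY low.
set h := height (X, Y).
have lowest p : pass p -> h <= height p by apply: low.
case/and3P: (pXY) => /= nXY fX fY.
have [hX hY] : energy X <= h /\ energy Y <= h.
  by rewrite /h /height !le_max !lexx orbT.
have two := saddle_of_two_ways lowest.
case/orP: nXY => [/eqP eYX|/existsP[B /eqP eYX]].
  exists X; apply: two => //; last by rewrite -eYX.
  by rewrite /h /height /= eYX maxxx.
have [ltXY|ltYX|eXY] := ltgtP (energy X) (energy Y).
- exists Y; apply: two => //; first by rewrite /h /height /= max_r // ltW.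
  apply: (@falls_to_flip _ _ B); last by rewrite eYX flipK.
  by rewrite -lt_energy_flip eYX flipK -eYX.
- exists X; apply: two => //; first by rewrite /h /height /= max_l // ltW.
  by apply: (@falls_to_flip _ _ B); rewrite -?lt_energy_flip -eYX.
have eX : energy X = h by rewrite /h /height /= eXY maxxx.
have eY : energy Y = h by rewrite -eXY.
have [f1X|f1X] := boolP (falls_to true X); first by exists X; apply: two.
have [f0Y|f0Y] := boolP (falls_to false Y); first by exists Y; apply: two.
have eXY' : X = flip Y B by rewrite eYX flipK.
have [sX|sX] := boolP (stuck X); last first.
  exists X; apply: (@saddle_of_level_pair h lowest false X B) => //.
  - by rewrite -eYX.
  - exact/negP.
  - by rewrite -eYX; apply/negP.
have [sY|sY] := boolP (stuck Y); last first.
  exists Y; apply: (@saddle_of_level_pair h lowest true Y B) => //.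
  - by rewrite -eXY'.
  - exact/negP.
  - by rewrite -eXY'; apply/negP.
move: fX fY (stuck_sides sX) (stuck_sides sY); rewrite !falls_to_stuck // eYX !inE.
move=> /eqP -> /eqP; rewrite addFb => /eqP <- <-; rewrite eqxx addFb => /esym/eqP eB.
by move: AB0; rewrite eB eqxx.
Qed.

End MountainPass.

(** * Homeomorphisms of subsets and faces of a brick *)

Section Homeomorphisms.
Implicit Types X Y Z : topologicalType.

(** Relative continuity in terms of open sets of the ambient spaces, which is
    how charts are cut out below. *)
Lemma within_continuousP X Y (A : set X) (f : X -> Y) :
  {within A, continuous f} <->
  forall W, open W -> exists2 V, open V & V `&` A = f @^-1` W `&` A.
Proof.
split=> [/continuousP cf W /cf /open_subspaceP //|cf].
by apply/continuousP => W /cf /open_subspaceP.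
Qed.

Lemma homeo_on_sym X Y (A : set X) (B : set Y) f : homeo_on A B f ->
  exists g, [/\ homeo_on B A g, {in A, cancel f g} & {in B, cancel g f}].
Proof. by move=> [g [fAB gBA [fg gf] cf cg]]; exists g; split=> //; exists f. Qed.

Lemma homeo_on_comp X Y Z (A : set X) (B : set Y) (C : set Z) f g :
  homeo_on A B f -> homeo_on B C g -> homeo_on A C (g \o f).
Proof.
have comp X1 X2 X3 (A1 : set X1) (A2 : set X2) (u : X1 -> X2) (v : X2 -> X3) :
    set_fun A1 A2 u -> {within A1, continuous u} -> {within A2, continuous v} ->
    {within A1, continuous (v \o u)}.
  move=> uA /within_continuousP cu /within_continuousP cv.
  apply/within_continuousP => W /cv[V /cu[U oU eU] eV]; exists U => //.
  rewrite eU; apply/seteqP; split=> x [] /= h xA; split=> //.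
    by have [] : (v @^-1` W `&` A2) (u x) by rewrite -eV; split=> //; exact: uA.
  by have [] : (V `&` A2) (u x) by rewrite eV; split=> //; exact: uA.
move=> [f' [fAB f'BA [ff' f'f] cf cf']] [g' [gBC g'CB [gg' g'g] cg cg']].
exists (f' \o g'); split.
- by move=> x /fAB /gBC.
- by move=> x /g'CB /f'BA.
- split=> x /set_mem xA /=; first by rewrite gg' ?ff' ?inE //; exact: fAB.
  by rewrite f'f ?g'g ?inE //; exact: g'CB.
- exact: (comp _ _ _ _ B).
- exact: (comp _ _ _ _ B).
Qed.

Lemma homeo_on_sub X Y (A A' : set X) (B : set Y) f :
  homeo_on A B f -> A' `<=` A -> homeo_on A' (f @` A') f.
Proof.
move=> [g [fAB gBA [fg gf] cf cg]] sA; exists g; split.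
- by move=> x xA; exists x.
- by move=> _ [x xA <-]; rewrite fg // inE; exact: sA.
- split=> x /set_mem; first by move=> /sA xA; rewrite fg ?inE.
  by case=> y /sA yA <-; rewrite fg ?inE.
- exact: continuous_subspaceW cf.
- by apply: continuous_subspaceW cg => _ [x /sA xA <-]; exact: fAB.
Qed.

Lemma homeo_on_open X Y (A : set X) (B W : set Y) f :
  homeo_on A B f -> open W -> exists U, [/\ open U,
    forall x, A x -> U x = W (f x) & homeo_on (A `&` U) (B `&` W) f].
Proof.
move=> fH oW; have [g [fAB gBA [fg gf] /within_continuousP cf cg]] := fH.
have [U oU eU] := cf _ oW.
have UW x : A x -> U x = W (f x).
  move=> xA; apply/propext; split=> h.
    by have [] : (f @^-1` W `&` A) x by rewrite -eU.
  by have [] : (U `&` A) x by rewrite eU.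
exists U; split=> //.
have -> : B `&` W = f @` (A `&` U).
  apply/seteqP; split=> [y [By Wy]|_ [x [xA Ux] <-]]; last first.
    by split; [exact: fAB|rewrite -UW].
  exists (g y); last by rewrite gf ?inE.
  by split; [exact: gBA|rewrite UW ?gf ?inE //; exact: gBA].
by apply: homeo_on_sub fH _ => x [].
Qed.

Variable R : realType.

Lemma euclidean_at_homeo X Y k (A : set X) (B : set Y) h p : homeo_on A B h ->
  A p -> @euclidean_at R X k A p -> @euclidean_at R Y k B (h p).
Proof.
move=> hH Ap [U [V [phi [oU Up oV pH]]]].
have [g [gH hg gh]] := homeo_on_sym hH.
have hAB x : A x -> B (h x) by case: hH => ? [+ _ _ _ _]; apply.
have [U' [oU' eU' gH']] := homeo_on_open gH oU.
exists U', V, (phi \o g); split=> //; last exact: homeo_on_comp gH' pH.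
by rewrite eU' ?hg ?inE //; exact: hAB.
Qed.

(** A half-space chart around some point also covers points whose first
    coordinate is positive, and these have Euclidean neighbourhoods.  So a
    nonempty manifold does not consist of boundary points only. *)
Lemma manifold_has_interior X k (A : set X) :
  manifold R k A -> A !=set0 -> exists2 x, A x & @euclidean_at R X k A x.
Proof.
move=> mA [x0 Ax0]; have [U [V [phi [oU Ux0 oV pH]]]] := mA _ Ax0.
have [psi [pAB pBA [pq qp] _ _]] := pH.
have [Vx0 Hx0] : (V `&` @half_space R k) (phi x0) by apply: pAB.
have oP : open [set v : 'rV[R]_k.+1 | 0 < v ord0 ord0].
  apply: (@open_comp _ _ (fun v : 'rV[R]_k.+1 => v ord0 ord0) [set t | 0 < t]).
    by move=> v _; exact: coord_continuous.
  exact: open_gt.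
have [v Vv v_gt0] : exists2 v, V v & 0 < v ord0 ord0.
  have /nbhs_ballP[e /= e0 sV] : nbhs (phi x0) V by exact: open_nbhs_nbhs.
  exists (\row_j (phi x0 ord0 j + e / 2)).
    (* shifting all coordinates stays in the sup-norm ball *)
    apply: sV; split=> // i j; rewrite -ball_normE /= ord1 mxE opprD addNKr normrN.
    by rewrite gtr0_norm ?divr_gt0 // ltr_pdivrMr // ltr_pMr // ltr1n.
  by rewrite mxE ltr_wpDl // divr_gt0.
set V' := V `&` [set v : 'rV[R]_k.+1 | 0 < v ord0 ord0].
have [U' [oU' eU' H']] := homeo_on_open pH (openI oV oP).
have [Apv Upv] : (A `&` U) (psi v) by apply: pBA; split=> //; exact: ltW.
have pv : phi (psi v) = v by rewrite qp // inE; split=> //; exact: ltW.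
exists (psi v) => //; exists (U `&` U'), V', phi; split.
- exact: openI.
- by split=> //; rewrite eU' // pv.
- exact: openI.
- have <- : (V `&` @half_space R k) `&` (V `&` [set v | 0 < v ord0 ord0]) = V'.
    by apply/seteqP; split=> [w [_ []]|w [Vw w0]] //; split=> //; split=> //; exact: ltW.
  by rewrite setIA.
Qed.

End Homeomorphisms.

Section BrickFaces.
Variables (R : realType) (n : nat) (B : brick R n).
Implicit Types f g h c d e : face B.

Local Notation dim := (@Defs.dim R n B).
Local Notation le := (is_face (@facets R n B)).

Lemma dim_is_face f c : le c f -> (dim c <= dim f)%N.
Proof.
case/connectP=> p; elim: p f => [|g p IH] f /= => [_ -> //|/andP[gf pp] /(IH _ pp)].
by rewrite -(dim_facet gf) => /leqW.
Qed.

Lemma is_face_cases f c : le c f -> c = f \/ exists2 g, g \in facets f & le c g.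
Proof.
case/connectP=> -[|g p] /= => [_ -> |/andP[gf pp] ->]; first by left.
by right; exists g => //; apply/connectP; exists p.
Qed.

Lemma is_face_refl f : le f f. Proof. exact: connect0. Qed.

Lemma is_face_in_facet f g c : g \in facets f -> le c g -> le c f.
Proof. by move=> gf; apply: connect_trans; exact: connect1. Qed.

Lemma is_face_dim_eq f c : le c f -> dim c = dim f -> c = f.
Proof.
move=> /is_face_cases[//|[g gf /dim_is_face cg] e].
by move: cg; rewrite e -(dim_facet gf) ltnn.
Qed.

Lemma is_face_dim_facet f c : le c f -> (dim c).+1 = dim f -> c \in facets f.
Proof.
move=> /is_face_cases[-> /esym/n_Sn //|[g gf cg] e].
by rewrite (is_face_dim_eq cg) //; apply: succn_inj; rewrite e -(dim_facet gf).
Qed.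

Lemma facetsP f g : g \in facets f -> exists2 k, dim f = k.+1 &
  [/\ cell f !=set0, compact (cell f), manifold R k (cell f)
    & tiles_boundary R cell (@facets R n B) k f].
Proof.
move=> gf; have := faceP f; rewrite /brick_face -(dim_facet gf).
by exists (dim g).
Qed.

Lemma cell_facet f g : g \in facets f -> cell g `<=` cell f.
Proof.
move=> gf x gx; have [k _ [_ _ _ [bd _ _]]] := facetsP gf.
by have [] : manifold_boundary R k (cell f) x by rewrite bd; exists g.
Qed.

Lemma cell_is_face f c : le c f -> cell c `<=` cell f.
Proof.
case/connectP=> p; elim: p f => [|g p IH] f /= => [_ -> //|/andP[gf pp] /(IH _ pp)].
by move/subset_trans; apply; exact: cell_facet.
Qed.

(** The face-to-face condition on two facets propagates to any two faces: pass to
    facets of [h] containing them, find a common face of these two facets at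
    [x], and intersect it inside one facet with [c] and inside the other with
    [e]. *)
Lemma common_face h c e x : le c h -> le e h -> cell c x -> cell e x ->
  exists d, [/\ le d c, le d e & cell d x].
Proof.
have [m] := ubnP (dim h); elim: m h c e => // m IH h c e hm ch eh cx ex.
case: (is_face_cases ch) => [->|[g1 g1h cg1]]; first by exists e; rewrite is_face_refl.
case: (is_face_cases eh) => [->|[g2 g2h eg2]]; first by exists c; rewrite is_face_refl.
have lt g : g \in facets h -> (dim g < m)%N by move/dim_facet => dg; rewrite dg.
have [eg|neg] := eqVneq g1 g2; first by apply: (IH g1) => //; [exact: lt|rewrite eg].
have [k _ [_ _ _ [_ tile _]]] := facetsP g1h.
have : (cell g1 `&` cell g2) x.
  by split; [exact: cell_is_face cg1 _ cx|exact: cell_is_face eg2 _ ex].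
rewrite (tile _ _ g1h g2h neg) => -[d /andP[dg1 dg2] dx].
have [d1 [d1c d1d d1x]] := IH g1 c d (lt _ g1h) cg1 dg1 cx dx.
have [d2 [d2d1 d2e d2x]] := IH g2 d1 e (lt _ g2h) (connect_trans dg2 d1d) eg2 d1x ex.
by exists d2; split=> //; exact: connect_trans d1c d2d1.
Qed.

(** Defined combinatorially; for a face of positive dimension these are the points
    outside the manifold boundary, as the facets tile it. *)
Definition relative_interior f : set B :=
  [set x | cell f x /\ forall g, g \in facets f -> ~ cell g x].

Lemma relative_interior_nonempty f : relative_interior f !=set0.
Proof.
have := faceP f; rewrite /brick_face; case: (dim f) => [[[x ex] f0]|k].
  by exists x; split; [rewrite ex|move=> g; rewrite f0 inE].
move=> [ne _ mf [bd _ _]]; have [x fx ix] := manifold_has_interior mf ne.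
exists x; split=> // g gf gx; have [] : manifold_boundary R k (cell f) x.
  by rewrite bd; exists g.
by move=> _ /(_ ix).
Qed.

(** A common face of [c] and [e] at a relative interior point of [c] can only be
    [c] itself. *)
Lemma is_face_of_relative_interior c e x : relative_interior c x -> cell e x -> le c e.
Proof.
move=> [cx nx] ex; have [d [dc de dx]] := common_face (face_top c) (face_top e) cx ex.
case: (is_face_cases dc) => [<- //|[g gc dg]].
by case: (nx g gc); exact: cell_is_face dg _ dx.
Qed.

Lemma is_face_of_cell_subset c e : cell c `<=` cell e -> le c e.
Proof.
by move=> ce; have [x cx] := relative_interior_nonempty c;
  apply: (is_face_of_relative_interior cx); case: cx => /ce.
Qed.

Lemma relative_interior_unique c e x : dim c = dim e ->
  relative_interior c x -> cell e x -> c = e.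
Proof. by move=> dce cx ex; apply: is_face_dim_eq dce; exact: is_face_of_relative_interior cx ex. Qed.

Lemma manifold_boundaryP f k x : dim f = k.+1 -> cell f x ->
  (~ @euclidean_at R B k (cell f) x) <-> exists2 g, g \in facets f & cell g x.
Proof.
move=> df fx; have := faceP f; rewrite /brick_face df => -[_ _ _ [bd _ _]].
split=> [nx|[g gf gx]].
  have : manifold_boundary R k (cell f) x by [].
  by rewrite bd => -[g gf gx]; exists g.
have : manifold_boundary R k (cell f) x by rewrite bd; exists g.
by case.
Qed.

Lemma dim_facet_top f : f \in facets (top B) -> (dim f).+1 = n.
Proof. by move/dim_facet; rewrite dim_top. Qed.

Lemma facet_topP f : (f \in facets (top B)) = ((dim f).+1 == n).
Proof.
apply/idP/eqP => [/dim_facet_top //|df].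
by apply: is_face_dim_facet; rewrite ?dim_top //; exact: face_top.
Qed.

End BrickFaces.

(** * Faces matched by a gluing map *)

Section OneGluing.
Variables (R : realType) (n : nat) (B1 B2 : brick R n) (G : gluing B1 B2).
Local Notation dim := (@Defs.dim R n _).

Lemma gdom_facet f : f \in gdom G -> f \in facets (top B1).
Proof. exact: (fintype.subsetP (gdom_facets G)). Qed.

Lemma gcod_facet f : f \in gcod G -> f \in facets (top B2).
Proof. exact: (fintype.subsetP (gcod_facets G)). Qed.

Lemma gmap_inj : {in union_of (gdom G) &, injective (gmap G)}.
Proof.
have [g [_ _ [gK _] _ _]] := gmap_homeo G.
by move=> x y xD yD e; rewrite -(gK x xD) -(gK y yD) e.
Qed.

Lemma gmap_union x : union_of (gdom G) x -> union_of (gcod G) (gmap G x).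
Proof. by have [g [+ _ _ _ _]] := gmap_homeo G; apply. Qed.

Lemma gcod_of_relative_interior f' y : f' \in facets (top B2) ->
  relative_interior f' y -> union_of (gcod G) y -> f' \in gcod G.
Proof.
move=> f't yi [g gc gy].
suff -> : f' = g by [].
apply: (relative_interior_unique _ yi gy); apply: succn_inj.
by rewrite !dim_facet_top //; exact: gcod_facet.
Qed.

(** The point is chosen in the relative interior of the image face and pulled back.
    Its preimage is then in the relative interior of [f]: otherwise a facet of
    [f] would be mapped onto a face of too small a dimension to contain it. *)
Lemma gluing_mate f : f \in gdom G -> exists f',
  [/\ f' \in gcod G, gmap G @` cell f = cell f'
    & exists2 x, relative_interior f x & relative_interior f' (gmap G x)].
Proof.
move=> fd; have [f' [df' ef']] := gluing_faces fd (is_face_refl f).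
have [y yi] := relative_interior_nonempty f'.
have f't : f' \in facets (top B2).
  by rewrite facet_topP df' dim_facet_top //; exact: gdom_facet.
have [x fx xy] : (gmap G @` cell f) y by rewrite ef'; case: yi.
have f'c : f' \in gcod G.
  apply: (gcod_of_relative_interior f't yi).
  by rewrite -xy; apply: gmap_union; exists f.
exists f'; split=> //; exists x; last by rewrite xy.
split=> // g gf gx.
have [d [dd ed]] := gluing_faces fd (is_face_in_facet gf (is_face_refl g)).
have dy : cell d y by rewrite -ed; exists x.
have := dim_is_face (is_face_of_relative_interior yi dy).
by rewrite dd df' -(dim_facet gf) ltnn.
Qed.

Lemma gluing_comate f' : f' \in gcod G -> exists2 f,
  f \in gdom G & gmap G @` cell f = cell f'.
Proof.
move=> f'c; have [y yi] := relative_interior_nonempty f'.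
have [h [_ hB [_ hK] _ _]] := gmap_homeo G.
have yU : union_of (gcod G) y by exists f' => //; case: yi.
have [f fd fx] := hB _ yU; exists f => //.
have [f'' [f''c ef _]] := gluing_mate fd; rewrite ef; congr cell; apply/esym.
apply: (@relative_interior_unique _ _ _ _ _ y) => //.
  by apply: succn_inj; rewrite !dim_facet_top ?gcod_facet.
by rewrite -ef; exists (h y) => //; rewrite hK ?inE.
Qed.

Section Mates.
Variables (f : face B1) (f' : face B2).
Hypotheses (fd : f \in gdom G) (f'c : f' \in gcod G).
Hypothesis ff' : gmap G @` cell f = cell f'.

Let dff' : dim f = dim f'.
Proof. by apply: succn_inj; rewrite !dim_facet_top ?gcod_facet ?gdom_facet. Qed.

Let sub_dom c : c \in facets f -> cell c `<=` union_of (gdom G).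
Proof. by move=> cf x cx; exists f => //; exact: cell_facet cf _ cx. Qed.

Lemma mate_facet c : c \in facets f ->
  exists2 c', c' \in facets f' & gmap G @` cell c = cell c'.
Proof.
move=> cf; have [c' [dc' ec']] := gluing_faces fd (is_face_in_facet cf (is_face_refl c)).
exists c' => //; apply: is_face_dim_facet.
  by apply: is_face_of_cell_subset; rewrite -ec' -ff'; apply: image_subset; exact: cell_facet.
by rewrite dc' (dim_facet cf).
Qed.

(** A relative interior point of [c'] is a manifold boundary point of [f'], so its
    preimage is one of [f] by homeomorphism invariance, and lies in a facet
    of [f]; the image of that facet is a face of the dimension of [c'] through
    this point. *)
Lemma comate_facet c' : c' \in facets f' ->
  exists2 c, c \in facets f & gmap G @` cell c = cell c'.
Proof.
move=> c'f'; have [y yi] := relative_interior_nonempty c'.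
have [x fx xy] : (gmap G @` cell f) y by rewrite ff'; apply: cell_facet c'f' _ _; case: yi.
have df' : dim f' = (dim c').+1 by rewrite (dim_facet c'f').
have [] : exists2 c, c \in facets f & cell c x.
  apply/(manifold_boundaryP (k := dim c')); rewrite ?dff' // => ex.
  have : exists2 g, g \in facets f' & cell g y by exists c' => //; case: yi.
  rewrite -(manifold_boundaryP df') -?xy -?ff'; last by exists x.
  apply; apply: euclidean_at_homeo ex => //.
  by apply: homeo_on_sub (gmap_homeo G) _ => z fz; exists f.
move=> c cf cx; exists c => //; have [d d'f' ed] := mate_facet cf.
rewrite ed; congr cell; apply/esym; apply: (@relative_interior_unique _ _ _ _ _ y) => //.
  by apply: succn_inj; rewrite (dim_facet d'f') (dim_facet c'f').
by rewrite -ed; exists x.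
Qed.

Lemma card_mate_facets (P : pred (face B1)) (P' : pred (face B2)) :
  (forall c c', c \in facets f -> gmap G @` cell c = cell c' -> P c = P' c') ->
  #|[set c in facets f | P c]%SET| = #|[set c in facets f' | P' c]%SET|.
Proof.
move=> PP'.
have mateE c : {c' | c \in facets f -> c' \in facets f' /\ gmap G @` cell c = cell c'}.
  have [cf|] := boolP (c \in facets f); last by exists f'.
  by apply: cid; have [c' c'f e] := mate_facet cf; exists c'.
pose m c := sval (mateE c).
have mP c : c \in facets f -> m c \in facets f' /\ gmap G @` cell c = cell (m c).
  by rewrite /m; case: (mateE c).
have minj : {in [set c in facets f | P c]%SET &, injective m}.
  move=> c d; rewrite !inE => /andP[/[dup] cf /mP[_ ec] _] /andP[/[dup] df /mP[_ ed] _] e.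
  apply: cell_inj; move: ec; rewrite e -ed => ecd.
  apply/seteqP; split=> x.
    move=> cx; have [z dz /gmap_inj zx] : (gmap G @` cell d) (gmap G x).
      by rewrite -ecd; exists x.
    by rewrite -zx // inE; [exact: sub_dom df _ dz|exact: sub_dom cf _ cx].
  move=> dx; have [z cz /gmap_inj zx] : (gmap G @` cell c) (gmap G x).
    by rewrite ecd; exists x.
  by rewrite -zx // inE; [exact: sub_dom cf _ cz|exact: sub_dom df _ dx].
rewrite -(card_in_imset minj); apply: eq_card => c'; rewrite [RHS]inE.
apply/imsetP/andP => [[c /[!inE]/andP[cf Pc] ->]|[c'f' Pc']].
  by have [? e] := mP _ cf; rewrite -(PP' _ _ cf e).
have [c cf e] := comate_facet c'f'; exists c.
  by rewrite inE cf (PP' _ _ cf e).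
by apply: cell_inj; rewrite -e; have [] := mP _ cf.
Qed.

End Mates.
End OneGluing.

(** * Classes of the glued space *)

(** Indices with decidable equality make this free of axioms. *)
Lemma existT_inj2 (I : eqType) (T : I -> Type) (i : I) (x y : T i) :
  existT T i x = existT T i y -> x = y.
Proof. exact: (@inj_pair2_eq_dec I (@eq_comparable I)). Qed.

Section GluedFacets.
Variables (R : realType) (n : nat) (D : gluing_data R n).

Definition piece_face := {i : piece D & face (piece_brick i)}.
Implicit Types (x y z : pieces D) (u v : piece_face).

Definition pt (i : piece D) (p : piece_brick i) : pieces D := existT _ i p.
Definition pface (i : piece D) (f : face (piece_brick i)) : piece_face := existT _ i f.

Lemma pt_inj i : injective (@pt i).
Proof. by move=> p q; exact: existT_inj2. Qed.

(** Facets and points are packed with the index of their brick, so that equality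
    of points of different pieces can be transported to their facets without
    casts. *)
Definition on_facet z u := exists i (p : piece_brick i) (f : face (piece_brick i)),
  [/\ z = pt p, u = pface f, f \in facets (top (piece_brick i)) & cell f p].

Definition inside_facet z u := exists i (p : piece_brick i) (f : face (piece_brick i)),
  [/\ z = pt p, u = pface f, f \in facets (top (piece_brick i)) & relative_interior f p].

Lemma inside_facet_unique z u v : inside_facet z u -> on_facet z v -> v = u.
Proof.
move=> [i [p [f [-> -> ft fp]]]] [j [q [g [e -> gt gq]]]].
have ij : i = j by have := congr1 (@projT1 _ _) e.
destruct ij; have epq := pt_inj e; rewrite -{}epq in gq.
rewrite (relative_interior_unique _ fp gq) //.
by apply: succn_inj; rewrite !dim_facet_top.
Qed.

Definition dom_facet (k : Defs.glue D) u := exists2 f, f \in gdom (glue_map k) & u = pface f.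
Definition cod_facet (k : Defs.glue D) u := exists2 f, f \in gcod (glue_map k) & u = pface f.

Lemma dom_facet_once k l u : dom_facet k u -> dom_facet l u -> k = l.
Proof. by move=> [f ku ->] lu; apply: (glue_once (p := pface f)); left=> //; exists f. Qed.

Lemma cod_facet_once k l u : cod_facet k u -> cod_facet l u -> k = l.
Proof. by move=> [f ku ->] lu; apply: (glue_once (p := pface f)); right=> //; exists f. Qed.

(** A facet that is glued at both ends would be glued by a single map from a brick
    to itself. *)
Lemma dom_cod_facet k l u : dom_facet k u -> cod_facet l u -> False.
Proof.
move=> ku lu; have kl : k = l by apply: (glue_once (p := u)); [left|right].
move: ku lu; rewrite -kl => -[f _ ->] [g _ /(congr1 (@projT1 _ _)) /= e].
by have := src_neq_tgt k; rewrite e eqxx.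
Qed.

Lemma glue_step_facets x y : glue_step x y -> exists k u v,
  [/\ dom_facet k u, on_facet x u, cod_facet k v & on_facet y v].
Proof.
move=> [k [p [pU -> ->]]]; have [f fd fp] := pU; have [g gc gp] := gmap_union pU.
exists k, (pface f), (pface g); split; first by exists f.
- by exists (src k), p, f; split=> //; exact: gdom_facet fd.
- by exists g.
- by exists (tgt k), (gmap (glue_map k) p), g; split=> //; exact: gcod_facet gc.
Qed.

Lemma glue_class_closed (K : set (pieces D)) x y :
  (forall a b, glue_step a b -> K a <-> K b) ->
  clos_refl_sym_trans (pieces D) (@glue_step R n D) x y -> K x -> K y.
Proof.
move=> stepK xy; suff : K x <-> K y by move=> [].
elim: xy => {x y} [a b /stepK //|//|a b _ ->//|a b c _ -> _ -> //].
Qed.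

Lemma unglued_class z u : inside_facet z u ->
  (forall k, ~ dom_facet k u) -> (forall k, ~ cod_facet k u) ->
  forall z', clos_refl_sym_trans (pieces D) (@glue_step R n D) z z' -> z' = z.
Proof.
move=> zu nd nc z' zz'; apply: (glue_class_closed (K := [set z]) _ zz') => // a b.
move=> /glue_step_facets[k [v [w [kv av kw bw]]]]; split=> /= e; exfalso.
  by rewrite e in av; rewrite (inside_facet_unique zu av) in kv; exact: nd kv.
by rewrite e in bw; rewrite (inside_facet_unique zu bw) in kw; exact: nc kw.
Qed.

(** A gluing step that starts or ends at one of the two points involves a facet
    containing it, hence [f] or [f'], and so is made by the map [k]. *)
Lemma glued_class (k : Defs.glue D) f f' p : f \in gdom (glue_map k) ->
  f' \in gcod (glue_map k) -> relative_interior f p ->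
  relative_interior f' (gmap (glue_map k) p) ->
  forall z, clos_refl_sym_trans (pieces D) (@glue_step R n D) (pt p) z ->
  z = pt p \/ z = pt (gmap (glue_map k) p).
Proof.
move=> fd f'c fp f'p z pz.
have iu : inside_facet (pt p) (pface f).
  by exists (src k), p, f; split=> //; exact: gdom_facet fd.
have iv : inside_facet (pt (gmap (glue_map k) p)) (pface f').
  by exists (tgt k), (gmap (glue_map k) p), f'; split=> //; exact: gcod_facet f'c.
have du : dom_facet k (pface f) by exists f.
have cv : cod_facet k (pface f') by exists f'.
have pU : union_of (gdom (glue_map k)) p by exists f => //; case: fp.
apply: (glue_class_closed (K := [set z | z = pt p \/ z = pt (gmap (glue_map k) p)]) _ pz); last by left.
move=> {z pz} a b ab; have [l [u [v [lu au lv bv]]]] := glue_step_facets ab.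
have [k' [q [qU ea eb]]] := ab.
split=> /= -[] e.
- have kk' : k = k'.
    have [g gd gq] := qU; apply: (dom_facet_once du (l := k')); exists g => //.
    apply/esym; apply: (inside_facet_unique iu); rewrite -e ea.
    by exists (src k'), q, g; split=> //; exact: gdom_facet gd.
  destruct kk'; right; rewrite eb; congr (pt (gmap _ _)).
  by apply: pt_inj; rewrite -[RHS]e ea.
- rewrite e in au; rewrite (inside_facet_unique iv au) in lu.
  by case: (dom_cod_facet lu cv).
- rewrite e in bv; rewrite (inside_facet_unique iu bv) in lv.
  by case: (dom_cod_facet du lv).
- have kk' : k = k'.
    have [g gc gq] := gmap_union qU; apply: (cod_facet_once cv (l := k')); exists g => //.
    apply/esym; apply: (inside_facet_unique iv); rewrite -e eb.
    by exists (tgt k'), (gmap (glue_map k') q), g; split=> //; exact: gcod_facet gc.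
  destruct kk'; left; rewrite ea; congr pt.
  apply: (@gmap_inj _ _ _ _ (glue_map k)); rewrite ?inE //.
  by apply: pt_inj; rewrite -[RHS]e eb.
Qed.

Lemma glued_pointP i j (p : piece_brick i) (q : piece_brick j) :
  glued_point i p = glued_point j q <->
  clos_refl_sym_trans (pieces D) (@glue_step R n D) (pt p) (pt q).
Proof.
rewrite /glued_point; split=> [/eqmodP/asboolP //|h].
by apply/eqmodP/asboolP.
Qed.

Lemma glued_point_gmap (k : Defs.glue D) p : union_of (gdom (glue_map k)) p ->
  glued_point (src k) p = glued_point (tgt k) (gmap (glue_map k) p).
Proof. by move=> pU; apply/glued_pointP; apply: rst_step; exists k, p. Qed.

End GluedFacets.

(** * Facets of a brick complex *)

Section ComplexFacets.
Variables (R : realType) (n : nat) (M : brick_complex R n).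
Local Notation D := (cdata M).
Implicit Types (A B C : cbrick M) (F a : set M).

Lemma cmap_inj : injective (cmap M).
Proof.
by move=> x y e; have [g [_ _ [gK _] _ _]] := cmap_homeo M;
  rewrite -(gK x) ?inE // -(gK y) ?inE // e.
Qed.

Lemma cimage_mate (k : Defs.glue D) c c' : cell c `<=` union_of (gdom (glue_map k)) ->
  gmap (glue_map k) @` cell c = cell c' -> cimage c = cimage c' :> set M.
Proof.
move=> cU ec; rewrite /cimage -ec; apply/seteqP; split=> _ [p cp <-].
  by exists (gmap (glue_map k) p); [exists p|rewrite glued_point_gmap //; exact: cU].
by case: cp => q cq <-; exists q => //; rewrite glued_point_gmap //; exact: cU.
Qed.

Definition mated (u v : piece_face D) := exists k f f',
  [/\ f \in gdom (glue_map k), f' \in gcod (glue_map k),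
      gmap (glue_map k) @` cell f = cell f' & u = pface f /\ v = pface f'].

Lemma mated_neq u v : mated u v -> projT1 u != projT1 v.
Proof. by move=> [k [f [f' [_ _ _ [-> ->]]]]]; exact: src_neq_tgt. Qed.

Lemma cimage_eq_class A B f g p : g \in facets (top (piece_brick B)) ->
  cimage g = cimage f :> set M -> cell f p ->
  exists2 q, on_facet (pt q) (pface g) &
    clos_refl_sym_trans _ (@glue_step R n D) (@pt _ _ D A p) (@pt _ _ D B q).
Proof.
move=> gt gf fp.
have [q gq /cmap_inj /glued_pointP qp] : cimage g (cmap M (glued_point A p)).
  by rewrite gf; exists p.
exists q; last exact: rst_sym.
by exists B, q, g.
Qed.

Lemma same_image_glued k f f' : f \in gdom (glue_map k) -> f' \in gcod (glue_map k) ->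
  gmap (glue_map k) @` cell f = cell f' ->
  forall B (g : face (piece_brick B)), g \in facets (top (piece_brick B)) ->
  cimage g = cimage f :> set M -> pface g = pface f \/ pface g = pface f'.
Proof.
move=> fd f'c ff' B g gt gf.
have [f'' [_ ef'' [p pf pf'']]] := gluing_mate fd.
have ef : f'' = f' by apply: cell_inj; rewrite -ef''.
rewrite {}ef in ef'' pf''.
have [q qg pq] := cimage_eq_class gt gf (proj1 pf).
case: (glued_class fd f'c pf pf'' pq) => e; rewrite e in qg.
  left; apply: (inside_facet_unique (z := pt p)) => //.
  by exists (src k), p, f; split=> //; exact: gdom_facet fd.
right; apply: (inside_facet_unique (z := pt (gmap (glue_map k) p))) => //.
by exists (tgt k), (gmap (glue_map k) p), f'; split=> //; exact: gcod_facet f'c.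
Qed.

(** Facets with the image of [f] contain a point glued to a fixed relative interior
    point of [f]; the class of this point has at most one other element, in the
    facet glued to [f]. *)
Lemma same_image A (f : face (piece_brick A)) : f \in facets (top (piece_brick A)) ->
  exists2 v, v = pface f \/ mated (pface f) v \/ mated v (pface f)
  & forall B (g : face (piece_brick B)), g \in facets (top (piece_brick B)) ->
    cimage g = cimage f :> set M -> pface g = pface f \/ pface g = v.
Proof.
move=> ft.
have cim B C (g : face (piece_brick B)) (h : face (piece_brick C)) :
  @pface _ _ D _ g = pface h -> cimage g = cimage h :> set M.
  by move=> e; rewrite -[cimage g]/(cimage (projT2 (@pface _ _ D _ g))) e.
have [[k [f0 f0d e]]|nd] := pselect (exists k, dom_facet k (pface f)).
  have [f' [f'c ff' _]] := gluing_mate f0d; rewrite e; exists (pface f').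
    by right; left; exists k, f0, f'.
  by move=> B g gt gf; apply: (same_image_glued f0d f'c ff') => //; rewrite gf; exact: cim.
have [[k [f' f'c e]]|nc] := pselect (exists k, cod_facet k (pface f)).
  have [f0 f0d ff'] := gluing_comate f'c; rewrite e; exists (pface f0).
    by right; right; exists k, f0, f'.
  move=> B g gt gf; apply/or_comm; apply: (same_image_glued f0d f'c ff') => //.
  rewrite gf (cim _ _ _ _ e); apply/esym; apply: cimage_mate ff' => x fx.
  by exists f0.
exists (pface f); first by left.
move=> B g gt gf; have [p pf] := relative_interior_nonempty f.
have [q qg pq] := cimage_eq_class gt gf (proj1 pf).
have iu : inside_facet (@pt _ _ D A p) (pface f) by exists A, p, f.
have e := unglued_class iu _ _ pq; rewrite {}e in qg.
- by left; exact: inside_facet_unique qg.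
- by move=> k kf; apply: nd; exists k.
- by move=> k kf; apply: nc; exists k.
Qed.

Lemma same_image_mated A B (f : face (piece_brick A)) (g : face (piece_brick B)) :
  f \in facets (top (piece_brick A)) -> g \in facets (top (piece_brick B)) ->
  cimage g = cimage f :> set M ->
  pface g = pface f :> piece_face D \/ mated (pface f) (pface g) \/ mated (pface g) (pface f).
Proof.
move=> ft gt gf; have [v vf vP] := same_image ft.
by case: (vP _ _ gt gf) => [->|->]; [left|].
Qed.

Lemma pface_inj A : injective (@pface _ _ D A).
Proof. by move=> f g; exact: existT_inj2. Qed.

Lemma cimage_facet_inj A :
  {in facets (top (piece_brick A)) &, injective (@cimage _ _ M A)}.
Proof.
move=> f g ft gt /esym /(same_image_mated ft gt)[/pface_inj //|].
by move=> [] /mated_neq /=; rewrite eqxx.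
Qed.

Lemma brick_facets3 A B C F : brick_facets A F -> brick_facets B F ->
  brick_facets C F -> [\/ A = B, A = C | B = C].
Proof.
move=> [f ft fF] [g gt gF] [h ht hF]; have [v _ vP] := same_image ft.
case: (vP _ _ gt _); first by rewrite gF.
  by move/(congr1 (@projT1 _ _)) => /= ->; constructor 1.
move=> eg; case: (vP _ _ ht _); first by rewrite hF.
  by move/(congr1 (@projT1 _ _)) => /= ->; constructor 2.
by rewrite -eg => /(congr1 (@projT1 _ _)) /= ->; constructor 3.
Qed.

Definition card_facets_over A (f : face (piece_brick A)) a : nat :=
  #|[set c in facets f | cimage c == a]%SET|.

(** The gluing map is a bijection between the facets of the two facets and does
    not change images in [M]. *)
Lemma mated_card A B (f : face (piece_brick A)) (g : face (piece_brick B)) a :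
  @mated (pface f) (pface g) -> card_facets_over f a = card_facets_over g a.
Proof.
move=> [k [f0 [g0 [fd gc e [ef eg]]]]].
suff : card_facets_over f0 a = card_facets_over g0 a.
  rewrite -[card_facets_over f a]/(card_facets_over (projT2 (@pface _ _ D _ f)) a).
  rewrite -[card_facets_over g a]/(card_facets_over (projT2 (@pface _ _ D _ g)) a).
  by rewrite ef eg.
apply: (card_mate_facets fd gc e) => c c' cf ec.
rewrite (cimage_mate _ ec) // => x cx; exists f0 => //.
exact: cell_facet cf _ cx.
Qed.

(** The choice made in the multiplicity is harmless: every facet with the same
    image is equal or glued to [f]. *)
Lemma multiplicityE A (f : face (piece_brick A)) a :
  f \in facets (top (piece_brick A)) ->
  multiplicity (cimage f) a = card_facets_over f a.
Proof.
move=> ft; rewrite /multiplicity; case: xgetP => [m _ [B [g [gt gf ->]]]|/(_ (card_facets_over f a))].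
  rewrite -/(card_facets_over g a); case: (same_image_mated ft gt gf) => [e|[]/mated_card-> //].
  rewrite -[LHS]/(card_facets_over (projT2 (@pface _ _ D _ g)) a).
  by rewrite e.
by case; exists A, f.
Qed.

End ComplexFacets.

(** * Separating surfaces are proper *)

Section Separating.
Variables (R : realType) (n : nat) (M : brick_complex R n).
Implicit Types (A B C : cbrick M) (F a : set M) (X : {set cbrick M}) (S : set (set M)).

Definition separating X : set (set M) := [set F | exists A B,
  [/\ A \in X, B \notin X, brick_facets A F & brick_facets B F]].

Lemma brick_facets_cfacets A F : brick_facets A F -> cfacets F.
Proof. by exists A. Qed.

Lemma separating_surface X : surface (separating X).
Proof. by move=> F [A [B [_ _ AF _]]]; exact: brick_facets_cfacets AF. Qed.

Lemma separating_boundary X F : separating X F -> ~ boundary_facets F.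
Proof.
move=> [A [B [AX BX AF BF]]] [C [_ CF]].
by move: BX; rewrite -(CF _ BF) (CF _ AF) AX.
Qed.

Lemma not_boundaryP F A : brick_facets A F -> ~ boundary_facets F ->
  exists2 B, B != A & forall C, brick_facets C F <-> C = A \/ C = B.
Proof.
move=> AF nbF.
have [B BF BA] : exists2 B, brick_facets B F & B != A.
  apply: contrapT => nB; apply: nbF; exists A; split=> // B BF.
  by apply/esym/eqP; apply: contrapT => /negP BA; apply: nB; exists B.
exists B => // C; split=> [CF|[]-> //].
case: (brick_facets3 AF BF CF) => e; [|by left|by right].
by move: BA; rewrite e eqxx.
Qed.

Lemma separatingE X F A B : A != B -> brick_facets A F -> brick_facets B F ->
  separating X F <-> opposite X A B.
Proof.
move=> AB AF BF; rewrite /opposite; split; last first.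
  case AX: (A \in X); case BX: (B \in X) => // _.
    by exists A, B; rewrite AX BX.
  by exists B, A; rewrite AX BX.
move=> [C [E [CX EX CF EF]]].
have CE : C <> E by move=> e; move: EX; rewrite -e CX.
case: (brick_facets3 AF BF CF) => e; first by rewrite e eqxx in AB.
  case: (brick_facets3 AF BF EF) => e'; first by rewrite e' eqxx in AB.
    by case: CE; rewrite -e -e'.
  by rewrite e e' CX (negbTE EX).
case: (brick_facets3 AF BF EF) => e'; first by rewrite e' eqxx in AB.
  by rewrite e e' CX (negbTE EX).
by case: CE; rewrite -e -e'.
Qed.

Lemma cfacets_finite : finite_set (@cfacets _ _ M).
Proof.
apply: bigcup_finite => [|A _]; first exact: finite_finset.
by apply: finite_image; exact: finite_finset.
Qed.

(** All sums over sets of facets are turned into conditional sums over this one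
    list, where they can be exchanged and compared term by term. *)
Definition facet_list : seq (set M) := enum_fset (fset_set (@cfacets _ _ M)).

Lemma facet_listP F : F \in facet_list <-> cfacets F.
Proof.
rewrite /facet_list -[X in X <-> _]/(is_true (F \in fset_set (@cfacets _ _ M))).
by rewrite (in_fset_set cfacets_finite) in_setE; split.
Qed.

Lemma sum_facets (U : nmodType) S (G : set M -> U) : S `<=` @cfacets _ _ M ->
  \sum_(F \in S) G F = \sum_(F <- facet_list | F \in S) G F.
Proof.
move=> sS; rewrite -{1}(setIidr sS) fsbig_mkcondr (fsbig_finite _ _ cfacets_finite).
by rewrite [RHS]big_mkcond.
Qed.

Lemma sum_brick_facets (U : nmodType) A (G : set M -> U) :
  \sum_(F <- facet_list | F \in @brick_facets _ _ M A) G F =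
  \sum_(f in facets (top (piece_brick A))) G (cimage f).
Proof.
rewrite -sum_facets; last exact: brick_facets_cfacets.
rewrite /brick_facets fsbig_image; last first.
  by move=> f g /set_mem ft /set_mem gt; apply: cimage_facet_inj.
rewrite -[RHS]big_enum [RHS]fsbig_seq ?enum_uniq //.
apply: eq_fsbigl; apply/seteqP; split=> f /=; by rewrite mem_enum.
Qed.

(** Incidences of facets of [A] with faces over [a]: each face is in exactly two
    facets of [A], or in none. *)
Lemma even_card_facets_over A a :
  ~~ odd (\sum_(f in facets (top (piece_brick A))) card_facets_over f a).
Proof.
have two c : ~~ odd #|[set f in facets (top (piece_brick A)) | c \in facets f]%SET|.
  have [->|[f]] := set_0Vmem [set f in facets (top (piece_brick A)) | c \in facets f]%SET.
    by rewrite cards0.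
  rewrite inE => /andP[ft cf]; have [k _ [_ _ _ [_ _ cd]]] := facetsP ft.
  by rewrite (cd _ _ ft cf).
have card_sum f : card_facets_over f a =
    (\sum_(c : face (piece_brick A) | cimage c == a) (c \in facets f))%N.
  rewrite /card_facets_over -sum1_card big_mkcond [RHS]big_mkcond; apply: eq_bigr => c _.
  by rewrite inE andbC; case: (cimage c == a) => //=; case: (c \in _).
rewrite (eq_bigr _ (fun f _ => card_sum f)) exchange_big /=.
rewrite (big_morph odd oddD (erefl _)) /=; apply/negP; rewrite big1 // => c _.
apply/negbTE; move: (two c); rewrite -sum1_card big_mkcond [in X in _ -> X]big_mkcond /=.
congr (~~ odd _); apply: eq_bigr => f _; rewrite inE; case: (f \in _) => //=.
Qed.

Lemma multiplicity_boundary F a : boundary_facets F ->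
  ~ a `<=` \bigcup_(G in @boundary_facets _ _ M) G -> multiplicity F a = 0%N.
Proof.
move=> bF na; have [A [[f ft fF] _]] := bF; rewrite -fF multiplicityE //.
apply/eqP; rewrite cards_eq0; apply/eqP/setP => c; rewrite !inE.
apply/negP => /andP[cf /eqP ca]; apply: na; rewrite -ca => _ [p cp <-].
by exists F => //; rewrite -fF; exists p => //; exact: cell_facet cf _ cp.
Qed.

(** Count the facets over [a] by bricks of [X] in two ways.  Brick by brick the
    total is even; facet by facet, a facet contributes its multiplicity once for
    each of its bricks in [X], which is odd exactly on the separating surface. *)
Lemma separating_proper X : proper_surface (separating X).
Proof.
split; first exact: separating_surface.
  by apply/seteqP; split=> // F [/separating_boundary].
move=> a _ na; rewrite (sum_facets _ (@separating_surface X)).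
have even_bricks : ~~ odd (\sum_(A in X) 
    \sum_(F <- facet_list | F \in @brick_facets _ _ M A) multiplicity F a).
  rewrite (big_morph odd oddD (erefl _)) /=; apply/negP; rewrite big1 // => A _.
  rewrite sum_brick_facets; apply/negbTE; have := even_card_facets_over A a.
  by congr (~~ odd _); apply: eq_bigr => f ft; rewrite multiplicityE.
move: even_bricks; rewrite (exchange_big_dep predT) //=.
rewrite !(big_morph odd oddD (erefl _)) /= [in X in _ -> X]big_mkcond /=.
rewrite (eq_big_seq (fun F => if F \in separating X then odd (multiplicity F a) else false)) // => F.
move=> /facet_listP[A _ AF].
have [bF|nbF] := pselect (boundary_facets F).
  by rewrite multiplicity_boundary //= big1 //; case: ifP.
have [B BA BF] := not_boundaryP AF nbF.
have AB : A != B by rewrite eq_sym.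
have BF' : brick_facets B F by apply/BF; right.
rewrite (eq_bigl (fun C => (C \in X) && ((C == A) || (C == B)))); last first.
  move=> C; congr (_ && _); apply/idP/orP => [/set_mem/BF[]->|[]/eqP->]; rewrite ?eqxx; auto.
    exact/mem_set.
  exact/mem_set.
have -> : (F \in separating X) = opposite X A B.
  by apply/idP/idP => [/set_mem/(separatingE X AB AF BF')//|/(separatingE X AB AF BF')/mem_set].
rewrite big_mkcondl (bigD1 A) ?eqxx //= (bigD1 B) ?eqxx ?orbT //=.
rewrite big1 => [|C /andP[/andP[/orP[]/eqP-> ]]]; rewrite ?eqxx //.
rewrite /opposite; case: (A \in X); case: (B \in X); rewrite ?addn0 ?add0n //.
by rewrite oddD addbb.
Qed.

End Separating.

(** * Strength of a brick and cuts *)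

Section Strength.
Variables (R : realType) (n : nat) (M : brick_complex R n) (w : set M -> R).
Hypothesis w_ge0 : weight_system w.
Implicit Types (A B C : cbrick M) (F : set M) (X : {set cbrick M}).

Definition common_weight A B : R :=
  if A == B then 0 else weight w (@brick_facets _ _ M A `&` brick_facets B).

Lemma weight_ge0 S : S `<=` @cfacets _ _ M -> 0 <= weight w S.
Proof.
move=> sS; rewrite /weight sum_facets // big_seq_cond sumr_ge0 // => F.
by move=> /andP[_ /set_mem/sS]; exact: w_ge0.
Qed.

Lemma common_weight_ge0 A B : 0 <= common_weight A B.
Proof.
rewrite /common_weight; case: eqP => // _; apply: weight_ge0 => F [AF _].
exact: brick_facets_cfacets AF.
Qed.

Lemma common_weight_sym A B : common_weight A B = common_weight B A.
Proof. by rewrite /common_weight eq_sym setIC. Qed.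

(** An interior facet of [A] has a unique second brick [B], and lies in the
    separating surface when [A] and [B] are on opposite sides. *)
Lemma strength_separating A X :
  strength w A (separating X) = flip_cost common_weight X A.
Proof.
have sub T : @brick_interior_facets _ _ M A `&` T `<=` @cfacets _ _ M.
  by move=> F [[AF _] _]; exact: brick_facets_cfacets AF.
rewrite /strength /weight setDE !sum_facets //.
rewrite big_mkcond [X in _ - X]big_mkcond -sumrB /flip_cost.
have cw B : common_weight A B * (spin R X A * spin R X B) = \sum_(F <- facet_list M)
    if [&& B != A, F \in brick_facets A & F \in brick_facets B]
    then w F * (spin R X A * spin R X B) else 0.
  rewrite /common_weight eq_sym; case: eqP => /= [_|_].
    by rewrite mul0r big1.
  rewrite /weight sum_facets => [|F [AF _]]; last exact: brick_facets_cfacets AF.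
  by rewrite mulr_suml big_mkcond; apply: eq_bigr => F _; rewrite in_setI.
rewrite [RHS](eq_bigr _ (fun B _ => cw B)) exchange_big /=.
apply: eq_big_seq => F Fs; rewrite -big_mkcond /=.
have [AF|nAF] := pselect (brick_facets A F); last first.
  have nin T : F \in brick_interior_facets A `&` T = false.
    by apply/negP => /set_mem[[]].
  by rewrite !nin subrr big1 // => B /and3P[_ /set_mem].
have [bF|nbF] := pselect (boundary_facets F).
  have nin T : F \in brick_interior_facets A `&` T = false.
    by apply/negP => /set_mem[[]].
  rewrite !nin subrr big1 // => B /and3P[BA _ /set_mem BF]; have [C [_ CF]] := bF.
  by move: BA; rewrite -(CF _ BF) -(CF _ AF) eqxx.
have [B BA BF] := not_boundaryP AF nbF.
have AB : A != B by rewrite eq_sym.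
have BF' : brick_facets B F by apply/BF; right.
rewrite (eq_bigl (pred1 B)) => [|C]; last first.
  apply/and3P/eqP => [[CA _ /set_mem/BF[eC|//]]|->]; first by rewrite eC eqxx in CA.
  by split=> //; exact/mem_set.
rewrite big_pred1_eq spin_opposite; have sE := separatingE X AB AF BF'.
have inI T : (F \in brick_interior_facets A `&` T) = (F \in T).
  by apply/idP/idP => /set_mem; [case=> _ TF | move=> TF]; exact/mem_set.
rewrite !inI in_setC.
have -> : (F \in separating X) = opposite X A B.
  by apply/idP/idP => [/set_mem/sE //|/sE/mem_set].
by case: opposite; rewrite /= ?subr0 ?sub0r ?mulr1 ?mulrN1.
Qed.

(** A brick that misses the surface has nonnegative strength, so the requirement
    that a strict shortening move meets the surface is automatic. *)
Lemma strict_shortening_separating A X :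
  strict_shortening w (separating X) A <-> flip_cost common_weight X A < 0.
Proof.
rewrite -strength_separating; split=> [[] //|s0]; split=> //; split; last exact: ltW.
have [e|/eqP/set0P //] := pselect (brick_facets A `&` separating X = set0).
exfalso; move: s0.
have e' : brick_interior_facets A `&` separating X = set0.
  by apply/seteqP; split=> // F [[AF _] SF]; rewrite -e.
rewrite /strength e' /weight fsbig_set0 subr0 ltNge => /negP; apply.
by apply: weight_ge0 => F [[AF _] _]; exact: brick_facets_cfacets AF.
Qed.

Lemma shortening_separating A B X : opposite X A B -> 0 < common_weight A B ->
  flip_cost common_weight X A <= 0 -> shortening w (separating X) A.
Proof.
move=> oAB; rewrite /common_weight; case: eqP => [_|/eqP AB]; first by rewrite ltxx.
move=> AB0 sA; split; last by rewrite strength_separating.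
have [e|/eqP/set0P[F [AF BF]]] := pselect (brick_facets A `&` brick_facets B = set0).
  by move: AB0; rewrite e /weight fsbig_set0 ltxx.
by exists F; split=> //; apply/(separatingE X AB AF BF).
Qed.

Lemma compensates_separating A B X : opposite X A B ->
  `|flip_cost common_weight X A| + `|flip_cost common_weight X B|
    <= common_weight A B *+ 2 -> compensates w (separating X) A B.
Proof.
move=> oAB; rewrite /compensates !strength_separating mulr_natl /common_weight.
by case: eqP => // e; move: oAB; rewrite e /opposite eqxx.
Qed.

(** The partition is [X] and its complement: facets between the two classes are in
    the separating surface by definition. *)
Lemma saddle_unstable X : saddle common_weight X ->
  separating X !=set0 /\ unstable_minimal w (separating X).
Proof.
move=> [[A0 sA0] partner strict].
have short A B : flip_cost common_weight X A < 0 -> opposite X A B ->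
    flip_cost common_weight X B <= 0 ->
    `|flip_cost common_weight X A| + `|flip_cost common_weight X B|
      <= common_weight A B *+ 2 ->
    shortening w (separating X) A /\ shortening w (separating X) B.
  move=> sA oAB sB cAB.
  have AB0 : 0 < common_weight A B.
    rewrite -(pmulrn_lgt0 _ (isT : (0 < 2)%N)); apply: lt_le_trans cAB.
    by rewrite ltr_pwDl // normr_gt0 ltr0_neq0.
  have oBA : opposite X B A by rewrite /opposite eq_sym.
  split; first exact: (shortening_separating oAB AB0 (ltW sA)).
  by apply: (shortening_separating oBA); rewrite 1?common_weight_sym.
have [B0 [oAB0 sB0 cAB0]] := partner _ sA0.
have [shA0 shB0] := short _ _ sA0 oAB0 sB0 cAB0.
split; first by case: shA0 => -[F [_ SF]] _; exists F.
split; first exact: separating_proper.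
have sym A B : compensates w (separating X) A B -> compensates w (separating X) B A.
  by rewrite /compensates addrC setIC.
exists X, (~: X)%SET; split.
- exact: finset.setUCr.
- exact: finset.setICr.
- apply/set0Pn; move: oAB0; rewrite /opposite; case AX: (A0 \in X); first by exists A0.
  by case BX: (B0 \in X) => //; exists B0.
- apply/set0Pn; move: oAB0; rewrite /opposite; case AX: (A0 \in X); last by exists A0; rewrite inE AX.
  by case BX: (B0 \in X) => //; exists B0; rewrite inE BX.
split.
- by move=> A B AX; rewrite inE => BX F [AF BF]; exists A, B.
- split.
  + move: oAB0; rewrite /opposite; case AX: (A0 \in X); first by exists A0.
    by case BX: (B0 \in X) => //; exists B0.
  + move: oAB0; rewrite /opposite; case AX: (A0 \in X); last by exists A0; rewrite ?inE ?AX.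
    by case BX: (B0 \in X) => //; exists B0; rewrite ?inE ?BX.
  + by exists A0; rewrite ?finset.setUCr ?inE //; apply/strict_shortening_separating.
- split=> A AX /strict_shortening_separating sA; have [B [oAB sB cAB]] := partner _ sA;
    have [_ shB] := short _ _ sA oAB sB cAB; exists B; split=> //.
  + by move: oAB; rewrite /opposite AX inE; case: (B \in X).
  + exact: compensates_separating.
  + by move: AX oAB; rewrite /opposite inE => /negbTE->; case: (B \in X).
  + by apply: sym; exact: compensates_separating.
- move=> A B AX; rewrite inE => BX /strict_shortening_separating sA.
  move=> /strict_shortening_separating sB.
  have oAB : opposite X A B by rewrite /opposite AX (negbTE BX).
  by apply: compensates_separating => //; exact: strict.
Qed.

End Strength.

(* The empty surface vacuously has no strict shortening move, whatever the
   weights are; the surface asserted to exist is therefore non-empty. *)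
Theorem corollary4p3 (R : realType) (n : nat) (M : brick_complex R n)
    (w : set M -> R) (hw : weight_system w)
    (hw_nz : exists F : set M, interior_facets F /\ w F <> 0) :
  exists S : set (set M),
    S !=set0 /\ (stable_minimal w S \/ unstable_minimal w S).
Proof.
have [F [[[A0 _ AF] nbF] _]] := hw_nz.
have [B0 BA BF] := not_boundaryP AF nbF.
have AB : A0 != B0 by rewrite eq_sym.
have BF' : brick_facets B0 F by apply/BF; right.
have [[X [SX stX]]|nst] := pselect (exists X : {set cbrick M},
    separating X !=set0 /\ stuck (common_weight w) X).
  exists (separating X); split=> //; left; split; first exact: separating_proper.
  by move=> A /(strict_shortening_separating hw); rewrite ltNge (forallP stX A).
have [X /(saddle_unstable hw)[ne un]] : exists X, saddle (common_weight w) X.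
  apply: (saddle_exists (common_weight_sym w) (common_weight_ge0 hw) _ AB).
    by move=> A; rewrite /common_weight eqxx.
  move=> X stX; apply/eqP; apply: contrapT => /negP /(separatingE X AB AF BF') SF.
  by apply: nst; exists X; split=> //; exists F.
by exists (separating X); split=> //; right.
Qed.
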